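(* Let $x,y:\mathbb{R}_D$ be equipped with locators. Then one can construct locators for $-x$, $x+y$, $x\cdot y$, $\min(x,y)$ and $\max(x,y)$, and, given a proof of $x\mathrel{\#}0$, a locator for $x^{-1}$.
   Context: Work in Martin-Löf type theory with propositional truncation, function extensionality and propositional extensionality. A Dedekind real is a pair $x=(L,U)$ of proposition-valued predicates on $\mathbb{Q}$, writing $q<x$ for $q\in L$ and $x<r$ for $r\in U$, which is bounded, rounded, transitive and located ($q<r\Rightarrow\|(q<x)+(x<r)\|$). $\mathbb{R}_D$ is the type of Dedekind reals; $x<y:=\exists_{q:\mathbb{Q}}(x<q)\land(q<y)$, and $x\mathrel{\#}y:=(x<y)\lor(y<x)$. The algebraic operations are the usual ones on Dedekind cuts, characterized by: $q<-x\Leftrightarrow x<-q$; $-x<r\Leftrightarrow -r<x$; $q<x+y\Leftrightarrow\exists s.\,s<x\land q-s<y$; $x+y<r\Leftrightarrow\exists t.\,x<t\land y<r-t$; $q<xy\Leftrightarrow\exists a,b,c,d:\mathbb{Q}.\,q<\min(ac,ad,bc,bd)\land a<x<b\land c<y<d$; $xy<r\Leftrightarrow\exists a,b,c,d.\,\max(ac,ad,bc,bd)<r\land a<x<b\land c<y<d$; for $z>0$: $q<z^{-1}\Leftrightarrow qz<1$, $z^{-1}<r\Leftrightarrow 1<rz$; for $w<0$: $q<w^{-1}\Leftrightarrow 1<qw$, $w^{-1}<r\Leftrightarrow rw<1$; $q<\min(x,y)\Leftrightarrow q<x\land q<y$; $\min(x,y)<r\Leftrightarrow x<r\lor y<r$;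 $q<\max(x,y)\Leftrightarrow q<x\lor q<y$; $\max(x,y)<r\Leftrightarrow x<r\land y<r$. A locator for $x$ is a function $\prod_{q,r:\mathbb{Q}}(q<r)\to(q<x)+(x<r)$ into the untruncated disjoint sum. *)

(* Defs.v *)
(* Rationals are [rat], whose equality is Leibniz equality
   and whose order is boolean, hence decidable.  [Prop] plays the role of the
   universe of propositions, so that [exists] and [\/] are the propositionally
   truncated sum types: they do not eliminate into [Type]. *)
From mathcomp Require Import all_boot all_order all_algebra.
From mathcomp Require Import ring lra.

Set Implicit Arguments.
Unset Strict Implicit.
Unset Printing Implicit Defensive.

Import Order.TTheory GRing.Theory Num.Theory.
Local Open Scope ring_scope.

Definition bounded (L U : rat -> Prop) : Prop :=
  (exists q, L q) /\ (exists r, U r).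

Definition rounded (L U : rat -> Prop) : Prop :=
  (forall q, L q <-> exists q', q < q' /\ L q') /\
  (forall r, U r <-> exists r', r' < r /\ U r').

Definition transitive_cut (L U : rat -> Prop) : Prop :=
  forall q r, L q -> U r -> q < r.

Definition located (L U : rat -> Prop) : Prop :=
  forall q r, q < r -> L q \/ U r.

Record is_cut (L U : rat -> Prop) : Prop := IsCut {
  cut_bounded : bounded L U;
  cut_rounded : rounded L U;
  cut_transitive : transitive_cut L U;
  cut_located : located L U }.

(* [lower x q] is q < x and [upper x r] is x < r. *)
Record dreal : Type := DReal {
  lower : rat -> Prop;
  upper : rat -> Prop;
  dreal_cut : is_cut lower upper }.

Definition locator (x : dreal) : Type :=
  forall q r : rat, q < r -> {lower x q} + {upper x r}.

Definition ltD (x y : dreal) : Prop := exists q, upper x q /\ lower y q.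

Definition apartD (x y : dreal) : Prop := ltD x y \/ ltD y x.

Section CutLemmas.
Variable x : dreal.

Lemma lower_ex : exists q, lower x q.
Proof. by case: (dreal_cut x) => -[]. Qed.

Lemma upper_ex : exists q, upper x q.
Proof. by case: (dreal_cut x) => -[]. Qed.

Lemma lower_round q : lower x q -> exists q', q < q' /\ lower x q'.
Proof. by case: (dreal_cut x) => _ [h _] _ _ /h. Qed.

Lemma upper_round r : upper x r -> exists r', r' < r /\ upper x r'.
Proof. by case: (dreal_cut x) => _ [_ h] _ _ /h. Qed.

Lemma lower_lt q q' : q < q' -> lower x q' -> lower x q.
Proof. by case: (dreal_cut x) => _ [h _] _ _ ? ?; apply/h; exists q'. Qed.

Lemma lower_le q q' : q <= q' -> lower x q' -> lower x q.
Proof. by rewrite le_eqVlt => /orP[/eqP->//|]; exact: lower_lt. Qed.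

Lemma upper_lt r r' : r' < r -> upper x r' -> upper x r.
Proof. by case: (dreal_cut x) => _ [_ h] _ _ ? ?; apply/h; exists r'. Qed.

Lemma upper_le r r' : r' <= r -> upper x r' -> upper x r.
Proof. by rewrite le_eqVlt => /orP[/eqP->//|]; exact: upper_lt. Qed.

Lemma lower_upper q r : lower x q -> upper x r -> q < r.
Proof. by case: (dreal_cut x) => _ _ h _; exact: h. Qed.

Lemma dreal_located q r : q < r -> lower x q \/ upper x r.
Proof. by case: (dreal_cut x) => _ _ _; apply. Qed.

Lemma approx a b e : lower x a -> upper x b -> 0 < e ->
  exists a' b', [/\ a <= a', b' <= b, lower x a', upper x b' & b' - a' < e].
Proof.
move=> la ub e0.
have [n hn] : exists n : nat, b - a <= n%:R * (e / 3).
  exists (Num.bound ((b - a) / (e / 3))).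
  have h3 : 0 < e / 3 by lra.
  rewrite -ler_pdivrMr //; apply/ltW/archi_boundP.
  by apply: divr_ge0; [have := lower_upper la ub; lra | exact: ltW].
elim: n a la hn => [|n IH] a la hn.
  by have := lower_upper la ub; rewrite mul0r in hn; lra.
have [|l|u] := @dreal_located (a + e / 3) (a + e / 3 * 2); first by lra.
  have [|a' [b' [? ? ? ? ?]]] := IH _ l; first by rewrite mulrSr in hn; lra.
  by exists a', b'; split=> //; lra.
have [hb|hb] := leP (a + e / 3 * 2) b.
  by exists a, (a + e / 3 * 2); split=> //; lra.
by exists a, b; split=> //; lra.
Qed.

End CutLemmas.

Lemma is_cut_ext (L U L' U' : rat -> Prop) :
  (forall q, L q <-> L' q) -> (forall r, U r <-> U' r) ->
  is_cut L' U' -> is_cut L U.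
Proof.
move=> hL hU [[[q lq] [r ur]] [h1 h2] h3 h4]; split.
- by split; [exists q; apply/hL | exists r; apply/hU].
- split=> s.
    by split=> [/hL/h1 [t [? /hL ?]]|[t [? /hL ?]]]; [exists t|apply/hL/h1; exists t].
  by split=> [/hU/h2 [t [? /hU ?]]|[t [? /hU ?]]]; [exists t|apply/hU/h2; exists t].
- by move=> s t /hL ls /hU ut; exact: h3 ls ut.
- by move=> s t /h4[/hL|/hU]; [left|right].
Qed.

Lemma ratD_cut (p : rat) : is_cut (fun q => q < p) (fun r => p < r).
Proof.
split.
- by split; [exists (p - 1) | exists (p + 1)]; lra.
- split=> s; (split=> [?|[t []]]; [exists ((s + p) / 2)|]); lra.
- by move=> q r; lra.
- by move=> q r qr; have [?|?] := ltP q p; [left|right; lra].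
Qed.

Definition ratD (p : rat) : dreal := DReal (ratD_cut p).

Section Opp.
Variable x : dreal.
Definition oppD_lower (q : rat) : Prop := upper x (- q).
Definition oppD_upper (r : rat) : Prop := lower x (- r).

Lemma oppD_cut : is_cut oppD_lower oppD_upper.
Proof.
rewrite /oppD_lower /oppD_upper; split.
- have [q lq] := lower_ex x; have [r ur] := upper_ex x.
  by split; [exists (- r) | exists (- q)]; rewrite opprK.
- split=> s; split=> [|[t [st]]].
  + move=> /upper_round[t [ts ut]]; exists (- t); rewrite opprK; split=> //; lra.
  + by apply: upper_lt; lra.
  + move=> /lower_round[t [ts ut]]; exists (- t); rewrite opprK; split=> //; lra.
  + by apply: lower_lt; lra.
- by move=> q r uq lr; have := lower_upper lr uq; lra.
- move=> q r qr; have [|?|?] := @dreal_located x (- r) (- q); first by lra.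
    by right.
  by left.
Qed.

Definition oppD : dreal := DReal oppD_cut.
End Opp.

Section Add.
Variables x y : dreal.
Definition addD_lower (q : rat) : Prop :=
  exists s, lower x s /\ lower y (q - s).
Definition addD_upper (r : rat) : Prop :=
  exists t, upper x t /\ upper y (r - t).

Lemma addD_cut : is_cut addD_lower addD_upper.
Proof.
split.
- have [q lq] := lower_ex x; have [r ur] := upper_ex x.
  have [q' lq'] := lower_ex y; have [r' ur'] := upper_ex y.
  split; [exists (q + q'), q | exists (r + r'), r]; split=> //.
    by rewrite (_ : q + q' - q = q') //; ring.
  by rewrite (_ : r + r' - r = r') //; ring.
- split=> s; split.
  + move=> [a [la /lower_round[b [hb lb]]]]; exists (a + b); split; first by lra.
    by exists a; split=> //; rewrite (_ : a + b - a = b) //; ring.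
  + move=> [t [st [a [la h]]]]; exists a; split=> //.
    by apply: lower_lt h; lra.
  + move=> [a [la /upper_round[b [hb lb]]]]; exists (a + b); split; first by lra.
    by exists a; split=> //; rewrite (_ : a + b - a = b) //; ring.
  + move=> [t [st [a [la h]]]]; exists a; split=> //.
    by apply: upper_lt h; lra.
- move=> q r [a [la la']] [b [ub ub']].
  by have := lower_upper la ub; have := lower_upper la' ub'; lra.
- move=> q r qr; have [a0 la0] := lower_ex x; have [b0 ub0] := upper_ex x.
  have [|a [b [_ _ la ub hab]]] := @approx x a0 b0 (r - q) la0 ub0; first by lra.
  have [|?|?] := @dreal_located y (q - a) (r - b); first by lra.
    by left; exists a.
  by right; exists b.
Qed.

Definition addD : dreal := DReal addD_cut.
End Add.

Definition min4 (a b c d : rat) : rat :=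
  Num.min (Num.min a b) (Num.min c d).
Definition max4 (a b c d : rat) : rat :=
  Num.max (Num.max a b) (Num.max c d).

Lemma corners (a b c d s t : rat) : a <= s <= b -> c <= t <= d ->
  min4 (a * c) (a * d) (b * c) (b * d) <= s * t
    <= max4 (a * c) (a * d) (b * c) (b * d).
Proof.
move=> /andP[as_ sb] /andP[ct td].
rewrite /min4 /max4 !ge_min !le_max.
have [s0|s0] := leP 0 s; have [c0|c0] := leP 0 c; have [d0|d0] := leP 0 d.
all: apply/andP; split; rewrite ?orbA.
all: by do 3?[apply/orP; first [right; nra | left]]; nra.
Qed.

Section Mul.
Variables x y : dreal.
Definition mulD_lower (q : rat) : Prop :=
  exists a b c d : rat,
    [/\ q < min4 (a * c) (a * d) (b * c) (b * d),
        lower x a /\ upper x b & lower y c /\ upper y d].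
Definition mulD_upper (r : rat) : Prop :=
  exists a b c d : rat,
    [/\ max4 (a * c) (a * d) (b * c) (b * d) < r,
        lower x a /\ upper x b & lower y c /\ upper y d].

Lemma mulD_cut : is_cut mulD_lower mulD_upper.
Proof.
have [a0 la0] := lower_ex x; have [b0 ub0] := upper_ex x.
have [c0 lc0] := lower_ex y; have [d0 ud0] := upper_ex y.
split.
- split.
    exists (min4 (a0 * c0) (a0 * d0) (b0 * c0) (b0 * d0) - 1).
    by exists a0, b0, c0, d0; split=> //; lra.
  exists (max4 (a0 * c0) (a0 * d0) (b0 * c0) (b0 * d0) + 1).
  by exists a0, b0, c0, d0; split=> //; lra.
- split=> s; split.
  + move=> [a [b [c [d [h1 h2 h3]]]]].
    exists ((s + min4 (a * c) (a * d) (b * c) (b * d)) / 2); split; first by lra.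
    by exists a, b, c, d; split=> //; lra.
  + move=> [t [st [a [b [c [d [h1 h2 h3]]]]]]].
    by exists a, b, c, d; split=> //; lra.
  + move=> [a [b [c [d [h1 h2 h3]]]]].
    exists ((s + max4 (a * c) (a * d) (b * c) (b * d)) / 2); split; first by lra.
    by exists a, b, c, d; split=> //; lra.
  + move=> [t [st [a [b [c [d [h1 h2 h3]]]]]]].
    by exists a, b, c, d; split=> //; lra.
- move=> q r [a [b [c [d [h1 [la ub] [lc ud]]]]]].
  move=> [a' [b' [c' [d' [h1' [la' ub'] [lc' ud']]]]]].
  have := lower_upper la ub; have := lower_upper la ub'.
  have := lower_upper la' ub; have := lower_upper la' ub'.
  have := lower_upper lc ud; have := lower_upper lc ud'.
  have := lower_upper lc' ud; have := lower_upper lc' ud'.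
  move=> *.
  have [s /andP[s1 s2]] : exists s, (a <= s <= b) && (a' <= s <= b').
    by have [?|?] := leP a a'; [exists a'|exists a]; lra.
  have [t /andP[t1 t2]] : exists s, (c <= s <= d) && (c' <= s <= d').
    by have [?|?] := leP c c'; [exists c'|exists c]; lra.
  have /andP[? _] := corners s1 t1; have /andP[_ ?] := corners s2 t2; lra.
- move=> q r qr.
  have [M [M0 ha hb hc hd]] :
      exists M : rat, [/\ 0 < M, - M <= a0, b0 <= M, - M <= c0 & d0 <= M].
    exists (`|a0| + `|b0| + `|c0| + `|d0| + 1).
    have := ler_norm b0; have := ler_norm d0.
    have := ler_norm (- a0); have := ler_norm (- c0); rewrite !normrN.
    have := normr_ge0 a0; have := normr_ge0 b0.
    have := normr_ge0 c0; have := normr_ge0 d0.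
    by move=> *; split; lra.
  pose e := (r - q) / (M * 2).
  have e0 : 0 < e by apply: divr_gt0; lra.
  have eE : M * e * 2 = r - q by rewrite /e; field; lra.
  have [a [b [h1 h2 la ub hab]]] := approx la0 ub0 e0.
  have [c [d [h3 h4 lc ud hcd]]] := approx lc0 ud0 e0.
  have hw : forall s t s' t', a <= s <= b -> a <= s' <= b -> c <= t <= d ->
      c <= t' <= d -> s * t - s' * t' < r - q.
    move=> s t s' t' hs hs' ht ht'.
    have -> : s * t - s' * t' = s * (t - t') + (s - s') * t' by ring.
    have E1 : s * (t - t') < M * e.
      apply: le_lt_trans (ler_norm _) _; rewrite normrM.
      have H1 : `|s| <= M by rewrite ler_norml; lra.
      have H2 : `|t - t'| < e by rewrite ltr_norml; lra.
      have := normr_ge0 s; have := normr_ge0 (t - t'); nra.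
    have E2 : (s - s') * t' < M * e.
      apply: le_lt_trans (ler_norm _) _; rewrite normrM.
      have H1 : `|t'| <= M by rewrite ler_norml; lra.
      have H2 : `|s - s'| < e by rewrite ltr_norml; lra.
      have := normr_ge0 t'; have := normr_ge0 (s - s'); nra.
    lra.
  have hab' := lower_upper la ub; have hcd' := lower_upper lc ud.
  have haI : a <= a <= b by lra.
  have hbI : a <= b <= b by lra.
  have hcI : c <= c <= d by lra.
  have hdI : c <= d <= d by lra.
  have [s [t [hs ht hm]]] : exists s t, [/\ a <= s <= b, c <= t <= d &
      min4 (a * c) (a * d) (b * c) (b * d) = s * t].
    rewrite /min4 /Num.min; do ![case: ifP => _];
    by [exists a, c | exists a, d | exists b, c | exists b, d].
  have [s' [t' [hs' ht' hm']]] : exists s t, [/\ a <= s <= b, c <= t <= d &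
      max4 (a * c) (a * d) (b * c) (b * d) = s * t].
    rewrite /max4 /Num.max; do ![case: ifP => _];
    by [exists a, c | exists a, d | exists b, c | exists b, d].
  have := hw _ _ _ _ hs' hs ht' ht; rewrite -hm -hm' => hmm.
  have [hq|hq] := ltP q (min4 (a * c) (a * d) (b * c) (b * d)).
    by left; exists a, b, c, d.
  by right; exists a, b, c, d; split=> //; lra.
Qed.

Definition mulD : dreal := DReal mulD_cut.
End Mul.

Section MinMax.
Variables x y : dreal.
Definition minD_lower (q : rat) : Prop := lower x q /\ lower y q.
Definition minD_upper (r : rat) : Prop := upper x r \/ upper y r.
Definition maxD_lower (q : rat) : Prop := lower x q \/ lower y q.
Definition maxD_upper (r : rat) : Prop := upper x r /\ upper y r.

Lemma minD_cut : is_cut minD_lower minD_upper.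
Proof.
split.
- have [a la] := lower_ex x; have [b lb] := lower_ex y.
  have [r ur] := upper_ex x; split; last by exists r; left.
  have [h|h] := leP a b; [exists a|exists b]; split=> //.
    exact: lower_le lb.
  exact: lower_lt la.
- split=> s; split.
  + move=> [/lower_round[a [sa la]] /lower_round[b [sb lb]]].
    have [h|h] := leP a b; [exists a|exists b]; split=> //; split=> //.
      exact: lower_le lb.
    exact: lower_lt la.
  + by move=> [t [st [l1 l2]]]; split; apply: lower_lt; eauto.
  + by move=> [|] /upper_round[t [? ?]]; exists t; split=> //; [left|right].
  + by move=> [t [ts [|]]] /(upper_lt ts); [left|right].
- by move=> q r [l1 l2] [|]; exact: lower_upper.
- move=> q r qr.
  have [l1|?] := @dreal_located x _ _ qr; last by right; left.
  have [l2|?] := @dreal_located y _ _ qr; last by right; right.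
  by left.
Qed.

Lemma maxD_cut : is_cut maxD_lower maxD_upper.
Proof.
split.
- have [a la] := upper_ex x; have [b lb] := upper_ex y.
  have [r ur] := lower_ex x; split; first by exists r; left.
  have [h|h] := leP a b; [exists b|exists a]; split=> //.
    exact: upper_le la.
  exact: upper_lt lb.
- split=> s; split.
  + by move=> [|] /lower_round[t [? ?]]; exists t; split=> //; [left|right].
  + by move=> [t [ts [|]]] /(lower_lt ts); [left|right].
  + move=> [/upper_round[a [sa la]] /upper_round[b [sb lb]]].
    have [h|h] := leP a b; [exists b|exists a]; split=> //; split=> //.
      exact: upper_le la.
    exact: upper_lt lb.
  + by move=> [t [st [l1 l2]]]; split; apply: upper_lt; eauto.
- by move=> q r [l|l] [u1 u2]; apply: lower_upper l _.
- move=> q r qr.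
  have [?|u1] := @dreal_located x _ _ qr; first by left; left.
  have [?|u2] := @dreal_located y _ _ qr; first by left; right.
  by right.
Qed.

Definition minD : dreal := DReal minD_cut.
Definition maxD : dreal := DReal maxD_cut.
End MinMax.

Lemma ltD_ratl p x : ltD (ratD p) x <-> lower x p.
Proof.
split=> [[q [/= pq lq]]|/lower_round[q [pq lq]]]; first exact: lower_lt lq.
by exists q.
Qed.

Lemma ltD_ratr p x : ltD x (ratD p) <-> upper x p.
Proof.
split=> [[q [uq /= qp]]|/upper_round[q [pq lq]]]; first exact: upper_lt uq.
by exists q.
Qed.

Section Inv.
Variable x : dreal.

(* The two disjuncts are the cases 0 < x and x < 0, with q x the product in
   the Dedekind reals. *)
Definition invD_lower (q : rat) : Prop :=
  (ltD (ratD 0) x /\ ltD (mulD (ratD q) x) (ratD 1)) \/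
  (ltD x (ratD 0) /\ ltD (ratD 1) (mulD (ratD q) x)).
Definition invD_upper (r : rat) : Prop :=
  (ltD (ratD 0) x /\ ltD (ratD 1) (mulD (ratD r) x)) \/
  (ltD x (ratD 0) /\ ltD (mulD (ratD r) x) (ratD 1)).

Lemma pos_mul_lt1 q : lower x 0 ->
  ltD (mulD (ratD q) x) (ratD 1) <-> exists u, upper x u /\ q * u < 1.
Proof.
move=> x0; rewrite ltD_ratr /=; split.
  move=> [a [b [c [d [h [/= aq qb] [lc ud]]]]]]; exists d; split=> //.
  have cd := lower_upper lc ud.
  have /andP[_] : _ <= q * d <= _ := @corners a b c d q d ltac:(lra) ltac:(lra).
  by move=> h'; apply: le_lt_trans h' h.
move=> [u [uu qu]]; have u0 := lower_upper x0 uu.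
pose e := (1 - q * u) / (u * 2).
have e0 : 0 < e by apply: divr_gt0; lra.
have eE : e * u = (1 - q * u) / 2 by rewrite /e; field; lra.
exists (q - e), (q + e), 0, u; split=> //=; last by lra.
by rewrite /max4 !gt_max !mulr0 mulrBl mulrDl eE; nra.
Qed.

Lemma pos_mul_gt1 q : lower x 0 ->
  ltD (ratD 1) (mulD (ratD q) x) <->
  exists l, [/\ lower x l, 0 <= l & 1 < q * l].
Proof.
move=> x0; rewrite ltD_ratl /=; split.
  move=> [a [b [c [d [h [/= aq qb] [lc ud]]]]]]; exists (Num.max c 0).
  have cd := lower_upper lc ud; have d0 := lower_upper x0 ud.
  have hc : c <= Num.max c 0 <= d by rewrite le_max ge_max lexx; lra.
  have /andP[h' _] := @corners a b c d q _ ltac:(lra) hc.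
  split; [|by rewrite le_max lexx orbT|exact: lt_le_trans h h'].
  by rewrite /Num.max; case: ifP.
move=> [l [ll l0 ql]]; have [d ud] := upper_ex x.
have ld := lower_upper ll ud.
have {}l0 : 0 < l by rewrite lt_neqAle l0 andbT; apply/eqP => e; move: ql; rewrite -e mulr0; lra.
pose e := (q * l - 1) / (l * 2).
have e0 : 0 < e by apply: divr_gt0; lra.
have eE : e * l = (q * l - 1) / 2 by rewrite /e; field; lra.
have h1 : 1 < (q - e) * l by rewrite mulrBl eE; lra.
have h2 : 0 < q - e by rewrite -(pmulr_lgt0 _ l0); lra.
exists (q - e), (q + e), l, d; split=> //=; last by lra.
rewrite /min4 !lt_min h1 /=.
have h3 : (q - e) * l < (q - e) * d by rewrite ltr_pM2l.
have h4 : (q - e) * l < (q + e) * l by rewrite ltr_pM2r //; lra.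
have h5 : (q + e) * l < (q + e) * d by rewrite ltr_pM2l //; lra.
lra.
Qed.

Lemma neg_mul_lt1 q : upper x 0 ->
  ltD (mulD (ratD q) x) (ratD 1) <-> exists l, lower x l /\ q * l < 1.
Proof.
move=> x0; rewrite ltD_ratr /=; split.
  move=> [a [b [c [d [h [/= aq qb] [lc ud]]]]]]; exists c; split=> //.
  have cd := lower_upper lc ud.
  have /andP[_] : _ <= q * c <= _ := @corners a b c d q c ltac:(lra) ltac:(lra).
  by move=> h'; apply: le_lt_trans h' h.
move=> [l [ll ql]]; have l0 := lower_upper ll x0.
pose e := (1 - q * l) / (- l * 2).
have e0 : 0 < e by apply: divr_gt0; lra.
have eE : e * l = (q * l - 1) / 2 by rewrite /e; field; lra.
exists (q - e), (q + e), l, 0; split=> //=; last by lra.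
by rewrite /max4 !gt_max !mulr0 mulrBl mulrDl eE; lra.
Qed.

Lemma neg_mul_gt1 q : upper x 0 ->
  ltD (ratD 1) (mulD (ratD q) x) <->
  exists u, [/\ upper x u, u <= 0 & 1 < q * u].
Proof.
move=> x0; rewrite ltD_ratl /=; split.
  move=> [a [b [c [d [h [/= aq qb] [lc ud]]]]]]; exists (Num.min d 0).
  have cd := lower_upper lc ud; have d0 := lower_upper lc x0.
  have hc : c <= Num.min d 0 <= d by rewrite le_min ge_min lexx; lra.
  have /andP[h' _] := @corners a b c d q _ ltac:(lra) hc.
  split; [|by rewrite ge_min lexx orbT|exact: lt_le_trans h h'].
  by rewrite /Num.min; case: ifP.
move=> [u [uu u0 qu]]; have [c lc] := lower_ex x.
have cu := lower_upper lc uu.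
have {}u0 : u < 0 by rewrite lt_neqAle u0 andbT; apply/eqP => e; move: qu; rewrite e mulr0; lra.
pose e := (q * u - 1) / (- u * 2).
have e0 : 0 < e by apply: divr_gt0; lra.
have eE : e * u = (1 - q * u) / 2 by rewrite /e; field; lra.
have h1 : 1 < (q + e) * u by rewrite mulrDl eE; lra.
have h2 : q + e < 0 by rewrite -(nmulr_lgt0 _ u0); lra.
exists (q - e), (q + e), c, u; split=> //=; last by lra.
have h3 : (q + e) * u < (q + e) * c by rewrite ltr_nM2l.
have h4 : (q + e) * u < (q - e) * u by rewrite ltr_nM2r //; lra.
have h5 : (q - e) * u < (q - e) * c by rewrite ltr_nM2l //; lra.
by rewrite /min4 !lt_min; lra.
Qed.

End Inv.

Lemma posinv_cut (x : dreal) : lower x 0 ->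
  is_cut (fun q => exists u, upper x u /\ q * u < 1)
         (fun r => exists l, [/\ lower x l, 0 <= l & 1 < r * l]).
Proof.
move=> x0; have [u0 uu0] := upper_ex x; have [l0 [l0gt ll0]] := lower_round x0.
split.
- split; first by exists 0, u0; rewrite mul0r.
  exists (2 / l0), l0; split=> //; first exact: ltW.
  by rewrite divfK //; lra.
- split=> s; split.
  + move=> [u [uu h]]; have up := lower_upper x0 uu.
    exists ((s + u^-1) / 2).
    have hu : u^-1 * u = 1 by rewrite mulVf //; lra.
    have hs : s < u^-1 by rewrite -(ltr_pM2r up) hu.
    split; first by lra.
    by exists u; split=> //; nra.
  + move=> [t [st [u [uu h]]]]; have up := lower_upper x0 uu.
    by exists u; split=> //; nra.
  + move=> [l [ll lp h]].
    have {}lp : 0 < l by rewrite lt_neqAle lp andbT; apply/eqP => e; move: h; rewrite -e mulr0; lra.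
    exists ((s + l^-1) / 2).
    have hl : l^-1 * l = 1 by rewrite mulVf //; lra.
    have hs : l^-1 < s by rewrite -(ltr_pM2r lp) hl.
    split; first by lra.
    by exists l; split=> //; [exact: ltW|nra].
  + by move=> [t [ts [l [ll lp h]]]]; exists l; split=> //; nra.
- move=> q r [u [uu h]] [l [ll lp h']]; have lu := lower_upper ll uu.
  rewrite ltNge; apply/negP => rq.
  have r0 : 0 < r by rewrite ltNge; apply/negP => r0; nra.
  have : r * l <= r * u by rewrite ler_pM2l // ltW.
  have : r * u <= q * u by rewrite ler_pM2r //; lra.
  lra.
- move=> q r qr; have [q0|q0] := leP q 0.
    by left; exists u0; split=> //; have := lower_upper x0 uu0; nra.
  have r0 : 0 < r by lra.
  have [|/lower_round[l [hl ll]]|/upper_round[u [hu uu]]] :=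
    @dreal_located x r^-1 q^-1; first by rewrite ltf_pV2.
    right; exists l; split=> //.
      by apply/ltW; apply: lt_trans hl; rewrite invr_gt0.
    by rewrite -(ltr_pM2l r0) divff // in hl; lra.
  by left; exists u; split=> //; rewrite -(ltr_pM2l q0) divff // in hu; lra.
Qed.

Lemma ltD_asym x y : ltD x y -> ltD y x -> False.
Proof.
move=> [q [uq lq]] [r [ur lr]].
by have := lower_upper lr uq; have := lower_upper lq ur; lra.
Qed.

Lemma invD_lower_pos x q : ltD (ratD 0) x ->
  invD_lower x q <-> ltD (mulD (ratD q) x) (ratD 1).
Proof.
by move=> h; split=> [[[]|[/(ltD_asym h)]]|]//; left.
Qed.

Lemma invD_upper_pos x r : ltD (ratD 0) x ->
  invD_upper x r <-> ltD (ratD 1) (mulD (ratD r) x).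
Proof.
by move=> h; split=> [[[]|[/(ltD_asym h)]]|]//; left.
Qed.

Lemma invD_lower_neg x q : ltD x (ratD 0) ->
  invD_lower x q <-> ltD (ratD 1) (mulD (ratD q) x).
Proof.
by move=> h; split=> [[[/(ltD_asym h)]|[]]|]//; right.
Qed.

Lemma invD_upper_neg x r : ltD x (ratD 0) ->
  invD_upper x r <-> ltD (mulD (ratD r) x) (ratD 1).
Proof.
by move=> h; split=> [[[/(ltD_asym h)]|[]]|]//; right.
Qed.

Lemma invD_cut (x : dreal) : apartD x (ratD 0) ->
  is_cut (invD_lower x) (invD_upper x).
Proof.
case=> h; have := h; rewrite ?ltD_ratl ?ltD_ratr => x0.
  have y0 : lower (oppD x) 0 by rewrite /= /oppD_lower oppr0.
  apply: is_cut_ext (dreal_cut (oppD (DReal (posinv_cut y0)))) => q.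
    rewrite invD_lower_neg // neg_mul_gt1 //= /oppD_lower /= /oppD_lower; split.
      move=> [u [uu u0 hu]]; exists (- u); rewrite /oppD_upper /oppD_lower.
      by rewrite opprK mulrNN oppr_ge0; split.
    by move=> [l [ll l0 hl]]; exists (- l); rewrite mulrN -mulNr oppr_le0.
  rewrite invD_upper_neg // neg_mul_lt1 //= /oppD_upper /=; split.
    by move=> [l [ll hl]]; exists (- l); rewrite /oppD_upper opprK mulrNN.
  by move=> [l [ll hl]]; exists (- l); rewrite mulrN -mulNr.
apply: is_cut_ext (posinv_cut x0) => q.
  by rewrite invD_lower_pos // pos_mul_lt1.
by rewrite invD_upper_pos // pos_mul_gt1.
Qed.

Definition invD (x : dreal) (x_apart0 : apartD x (ratD 0)) : dreal :=
  DReal (invD_cut x_apart0).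

(* Main.v *)
(* Call a proposition semidecidable if it is equivalent to [exists n, p n] for
   a given boolean predicate [p] on the naturals.  A real has a locator exactly
   when its lower and upper cuts are semidecidable.  From a locator, q < x
   holds iff the locator answers "q < x" on some interval (q, q') (by
   roundedness), and dually for the upper cut.  Conversely, locatedness says
   that one of two semidecidable propositions holds, so unbounded search finds
   which, without choice axioms.  Semidecidability is preserved by conjunction,
   disjunction and existential quantification over a countable type, and each
   arithmetic operation defines its cuts from those of its arguments by these
   means only. *)
Require Import Defs.
From mathcomp Require Import all_boot all_order all_algebra.

Set Implicit Arguments.
Unset Strict Implicit.
Unset Printing Implicit Defensive.

Import Order.TTheory GRing.Theory Num.Theory.
Local Open Scope ring_scope.

Definition semidec (P : Prop) : Type :=
  {p : nat -> bool | P <-> exists n, p n}.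

Lemma semidec_count (T : countType) (p : T -> bool) (P : Prop) :
  (P <-> exists t, p t) -> semidec P.
Proof.
(* Numbers that decode to no element of [T] count as failures of the test. *)
move=> Pp; exists (fun n => oapp p false (unpickle n)).
rewrite Pp; split=> [[t pt]|[n]]; first by exists (pickle t); rewrite pickleK.
by case: unpickle => //= t pt; exists t.
Qed.

Lemma semidec_bool (b : bool) : semidec b.
Proof.
by apply: (@semidec_count unit (fun=> b)); split=> [|[]//]; exists tt.
Qed.

(** Dovetailing: one search runs over pairs of a candidate [t] and a stage [n] of the test for
    [P t]. *)
Lemma semidec_ex (T : countType) (P : T -> Prop) :
  (forall t, semidec (P t)) -> semidec (exists t, P t).
Proof.
move=> sP.
apply: (@semidec_count (T * nat)%type (fun tn => sval (sP tn.1) tn.2)).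
split=> [[t]|[[t n] /= ptn]].
  by case/(svalP (sP t)) => n ptn; exists (t, n).
by exists t; apply/(svalP (sP t)); exists n.
Qed.

Lemma semidec_and P Q : semidec P -> semidec Q -> semidec (P /\ Q).
Proof.
move=> [p Pp] [q Qq].
apply: (@semidec_count (nat * nat)%type (fun mn => p mn.1 && q mn.2)).
rewrite Pp Qq; split=> [[[m pm] [n qn]]|[[m n] /andP[/= pm qn]]].
  by exists (m, n); rewrite /= pm.
by split; [exists m | exists n].
Qed.

Lemma semidec_or P Q : semidec P -> semidec Q -> semidec (P \/ Q).
Proof.
move=> [p Pp] [q Qq]; exists (fun n => p n || q n).
rewrite Pp Qq; split=> [[[n pn]|[n qn]]|[n /orP[pn|qn]]].
- by exists n; rewrite pn.
- by exists n; rewrite qn orbT.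
- by left; exists n.
- by right; exists n.
Qed.

Lemma semidec_and3 P Q S :
  semidec P -> semidec Q -> semidec S -> semidec [/\ P, Q & S].
Proof.
move=> sP sQ sS; have [p pE] := semidec_and sP (semidec_and sQ sS).
by exists p; rewrite -pE; split=> [[]|[? []]].
Qed.

Lemma semidec_decide P Q : semidec P -> semidec Q -> P \/ Q -> {P} + {Q}.
Proof.
move=> [p Pp] [q Qq] PQ.
have ex_pq : exists n, p n || q n.
  by case: PQ => [/Pp[n pn]|/Qq[n qn]]; exists n; rewrite ?pn ?qn ?orbT.
(* The truncated [ex_pq] still yields an actual index, since its predicate is boolean on a countable
   type. If [p] fails at that index, [q] succeeds there. *)
have pqn := xchooseP ex_pq; case: (boolP (p (xchoose ex_pq))) => [pn|npn].
  by left; apply/Pp; exists (xchoose ex_pq).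
by right; apply/Qq; exists (xchoose ex_pq); rewrite (negPf npn) in pqn.
Qed.

Definition semidec_cut (x : dreal) : Type :=
  (forall q, semidec (lower x q)) * (forall r, semidec (upper x r)).

(** Matching on [idP] supplies the proof of [q < r] that the locator demands; pairs out of order
    count as no answer. *)
Definition answers_lower (x : dreal) (lx : locator x) (q r : rat) : bool :=
  if @idP (q < r) is ReflectT qr then lx q r qr else false.

Definition answers_upper (x : dreal) (lx : locator x) (q r : rat) : bool :=
  if @idP (q < r) is ReflectT qr then ~~ lx q r qr else false.

Lemma locator_semidec_cut x : locator x -> semidec_cut x.
Proof.
move=> lx; split.
  move=> q; apply: (@semidec_count _ (answers_lower lx q)); split.
    (* This [r] lies below [x], so the locator cannot place [x] below [r]. *)
    move=> /lower_round[r [qr lr]]; exists r; rewrite /answers_lower.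
    case: {-}_ / idP => // qr'; case: (lx _ _ _) => //= ur.
    by have := lower_upper lr ur; rewrite ltxx.
  by case=> r; rewrite /answers_lower; case: {-}_ / idP => // qr;
    case: (lx _ _ _).
move=> r; apply: (@semidec_count _ (answers_upper lx ^~ r)); split.
  move=> /upper_round[q [qr uq]]; exists q; rewrite /answers_upper.
  case: {-}_ / idP => // qr'; case: (lx _ _ _) => //= lq.
  by have := lower_upper lq uq; rewrite ltxx.
by case=> q; rewrite /answers_upper; case: {-}_ / idP => // qr;
    case: (lx _ _ _).
Qed.

Lemma semidec_cut_locator x : semidec_cut x -> locator x.
Proof.
by move=> [sl su] q r qr; apply: semidec_decide => //; exact: dreal_located.
Qed.

Lemma semidec_cut_ratD p : semidec_cut (ratD p).
Proof. by split=> q; exact: semidec_bool. Qed.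

Lemma semidec_ltD x y : semidec_cut x -> semidec_cut y -> semidec (ltD x y).
Proof. by move=> [_ ux] [ly _]; apply: semidec_ex => q; exact: semidec_and. Qed.

Lemma semidec_cut_oppD x : semidec_cut x -> semidec_cut (oppD x).
Proof. by move=> [lx ux]; split=> q; [exact: ux | exact: lx]. Qed.

Section BinaryOperations.
Variables x y : dreal.
Hypotheses (sx : semidec_cut x) (sy : semidec_cut y).

Lemma semidec_cut_addD : semidec_cut (addD x y).
Proof.
by case: sx sy => [lx ux] [ly uy]; split=> q; apply: semidec_ex => s;
  exact: semidec_and.
Qed.

Lemma semidec_cut_mulD : semidec_cut (mulD x y).
Proof.
case: sx sy => [lx ux] [ly uy]; split=> q; do 4![apply: semidec_ex => ?];
  by apply: semidec_and3; [exact: semidec_bool | exact: semidec_and ..].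
Qed.

Lemma semidec_cut_minD : semidec_cut (minD x y).
Proof.
case: sx sy => [lx ux] [ly uy].
by split=> q; [exact: semidec_and | exact: semidec_or].
Qed.

Lemma semidec_cut_maxD : semidec_cut (maxD x y).
Proof.
case: sx sy => [lx ux] [ly uy].
by split=> q; [exact: semidec_or | exact: semidec_and].
Qed.

End BinaryOperations.

(** The truncated [x_apart0] does not by itself compute the sign of [x]; both sign cases in the cuts
    of [invD] are searched at once. *)
Lemma semidec_cut_invD x (x_apart0 : apartD x (ratD 0)) :
  semidec_cut x -> semidec_cut (invD x_apart0).
Proof.
move=> sx; have s0 := semidec_cut_ratD 0; have s1 := semidec_cut_ratD 1.
have sm q := semidec_cut_mulD (semidec_cut_ratD q) sx.
by split=> q; apply: semidec_or; apply: semidec_and; apply: semidec_ltD.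
Qed.

Theorem theorem3p25 (x y : dreal) (lx : locator x) (ly : locator y) :
  locator (oppD x) *
  locator (addD x y) *
  locator (mulD x y) *
  locator (minD x y) *
  locator (maxD x y) *
  (forall x_apart0 : apartD x (ratD 0%R), locator (invD x_apart0)).
Proof.
have sx := locator_semidec_cut lx; have sy := locator_semidec_cut ly.
split; [do 4?split | move=> x_apart0]; apply: semidec_cut_locator.
- exact: semidec_cut_oppD.
- exact: semidec_cut_addD.
- exact: semidec_cut_mulD.
- exact: semidec_cut_minD.
- exact: semidec_cut_maxD.
- exact: semidec_cut_invD.
Qed.
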